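(* Let $I\subset\mathbb{R}$ be a nondegenerate interval, let $D:I^2\to\mathbb{R}$ be a deviation and let $(\xi_n)_{n\in\mathbb{N}}$ be a sequence of pairwise independent and identically distributed (real) random variables. Assume that (i) $D$ is Borel measurable in the first variable; (ii) $\mathbb{P}(\xi_1\in I)=1$ and $\xi_1$ satisfies the interior point condition with respect to $D$. Then $$\mathscr{M}_n^{D}(\xi_1,\ldots,\xi_n)\to \mathbb{M}^D(\xi_1)\qquad\text{almost surely as } n\to\infty.$$
   Context: All random variables are defined on a probability space $(\Omega,\mathcal{F},\mathbb{P})$. An interval is nondegenerate if it contains at least two distinct points. A function $D:I^2\to\mathbb{R}$ is a deviation if (a) for all $x\in I$, the function $I\ni t\mapsto D(x,t)$ is strictly decreasing and continuous, and (b) $D(t,t)=0$ for all $t\in I$. $D$ is Borel measurable in the first variable if, for all $t\in I$, the function $I\ni x\mapsto D(x,t)$ is Borel measurable. For $n\in\mathbb{N}$ and $x_1,\dots,x_n\in I$, the deviation mean $\mathscr{M}_n^D(x_1,\dots,x_n)$ is the unique solution $t\in I$ of $\sum_{i=1}^n D(x_i,t)=0$ (it exists, is unique, and lies in $[\min_i x_i,\max_i x_i]$). Since $\mathbb{P}(\xi_i\in I,\ i\in\mathbb{N})=1$, $\mathscr{M}_n^D(\xi_1,\dots,\xi_n)$ is defined almost surely. For a random variable $\xi$ with $\mathbb{P}(\xi\in I)=1$ let $I_\xi^D:=\{t\in I : \mathbb{E}(|D(\xi,t)|)<\infty\}$, which is a (possibly degenerate) subinterval of $I$. If there exists $t_0\in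 I_\xi^D$ with $\mathbb{E}(D(\xi,t_0))=0$, then it is unique; it is called the $D$-deviation mean of $\xi$ and is denoted by $\mathbb{M}^D(\xi)$. If $\mathbb{M}^D(\xi)$ exists and belongs to the interior of $I_\xi^D$, then $\xi$ is said to satisfy the interior point condition with respect to $D$. *)

(* Defs.v *)
From HB Require Import structures.
From mathcomp Require Import all_boot all_order all_algebra.
From mathcomp Require Import all_classical all_reals all_analysis.

Set Implicit Arguments.
Unset Strict Implicit.
Unset Printing Implicit Defensive.
Import Order.TTheory GRing.Theory Num.Theory.
Import numFieldNormedType.Exports.
Local Open Scope classical_set_scope.
Local Open Scope ring_scope.

Definition nondegenerate_interval (R : realType) (I : set R) : Prop :=
  is_interval I /\ (exists x y : R, [/\ I x, I y & x <> y]).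

(* Functions on [I x I] are represented by total functions [R -> R -> R]; the
   values off [I x I] are irrelevant (no hypothesis constrains them, and the
   means involve them only on null events). *)
Definition deviation (R : realType) (I : set R) (D : R -> R -> R) : Prop :=
  [/\ forall x, I x -> forall s t, I s -> I t -> s < t -> D x t < D x s,
      forall x, I x -> {within I, continuous (D x)}
    & forall t, I t -> D t t = 0].

Definition borel_fst (R : realType) (I : set R) (D : R -> R -> R) : Prop :=
  forall t, I t -> measurable_fun I (D ^~ t).

(* The solution is unique if [D] is a deviation, [0 < n] and every [x i] is in
   [I]; otherwise [get] may return an arbitrary value. *)
Definition deviation_mean (R : realType) (I : set R) (D : R -> R -> R)
    (n : nat) (x : 'I_n -> R) : R :=
  get [set t | I t /\ \sum_(i < n) D (x i) t = 0].

Section random_variables.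
Context d (T : measurableType d) (R : realType) (P : probability T R).
Implicit Types (I : set R) (D : R -> R -> R) (X : {RV P >-> R}).

(* The random variable D(X, t), set to 0 on the event [~ I (X w)], which is
   null in all uses, because [D] carries no information there. *)
Definition deviation_rv I D X (t : R) : T -> R :=
  (fun w => D (X w) t) \_ (X @^-1` I).

Definition deviation_dom I D X : set R :=
  [set t | I t /\ ('E_P[fun w => `|deviation_rv I D X t w|%R] < +oo)%E].

Definition is_deviation_mean_rv I D X (t : R) : Prop :=
  deviation_dom I D X t /\ ('E_P[deviation_rv I D X t] = 0)%E.

Definition deviation_mean_rv I D X : R :=
  get [set t | is_deviation_mean_rv I D X t].

Definition interior_point_condition I D X : Prop :=
  (exists t, is_deviation_mean_rv I D X t) /\
  interior (deviation_dom I D X) (deviation_mean_rv I D X).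

Definition pairwise_independent (X : nat -> {RV P >-> R}) : Prop :=
  forall i j, i <> j -> forall A B : set R, measurable A -> measurable B ->
    P ((X i @^-1` A) `&` (X j @^-1` B))
    = (P (X i @^-1` A) * P (X j @^-1` B))%E.

Definition identically_distributed (X : nat -> {RV P >-> R}) : Prop :=
  forall i j (A : set R), measurable A ->
    distribution P (X i) A = distribution P (X j) A.

End random_variables.

(* Main.v *)
(* Pairwise independence gives only additivity of variances, so the strong law
   is Etemadi's.  For nonnegative variables: truncate the i-th variable at
   level i; along each sequence of indices n = j * 2^m (m -> oo, j > 0 fixed)
   the variances of the averages are summable, so the averages converge almost
   surely; monotonicity of the partial sums then fills the gaps between
   consecutive multiples j * 2^m, (j + 1) * 2^m at the cost of a factor 1 + 1/j.

   For the theorem, let m be the deviation mean.  For s < m < t in the domain,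
   E D(xi, s) > 0 > E D(xi, t), so by the strong law almost surely the sums of
   D(xi_i, s) are eventually positive and those of D(xi_i, t) negative; the
   intermediate value theorem puts the empirical mean between s and t. *)

Require Import Defs.
From HB Require Import structures.
From mathcomp Require Import all_boot all_order all_algebra.
From mathcomp Require Import all_classical all_reals all_analysis.
From mathcomp Require Import measurable_realfun ring lra zify.

Set Implicit Arguments.
Unset Strict Implicit.
Unset Printing Implicit Defensive.
Import Order.TTheory GRing.Theory Num.Theory.
Import numFieldNormedType.Exports.
Local Open Scope classical_set_scope.
Local Open Scope ring_scope.

(** * Almost everywhere convergence from summable integrals *)

(** By monotone convergence the sum of the series has integral at most [C], so it is finite almost
    everywhere and its terms tend to 0. This serves in place of Chebyshev with Borel-Cantelli, once
    for squared averages and once for indicators. *)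
Lemma ae_cvg0_bounded_series d (T : measurableType d) (R : realType)
    (mu : {measure set T -> \bar R}) (X : (T -> R)^nat) (C : R) :
    (forall n, measurable_fun setT (X n)) -> (forall n w, 0 <= X n w) ->
    (forall N, (\sum_(0 <= n < N) \int[mu]_w (X n w)%:E <= C%:E)%E) ->
  {ae mu, forall w, X n w @[n --> \oo] --> 0}.
Proof.
move=> mX X0 XC.
have mEX n : measurable_fun setT (EFin \o X n) by exact/measurable_EFinP.
pose F w := (\sum_(0 <= n <oo) (X n w)%:E)%E.
have F0 w : (0 <= F w)%E by apply: nneseries_ge0 => n _ _; rewrite lee_fin.
have intF : mu.-integrable setT F.
  apply/integrableP; split.
    have := @ge0_emeasurable_sum _ _ _ setT (fun n => EFin \o X n) xpredT.
    by apply => // k w _ _; rewrite /= lee_fin.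
  under eq_integral do rewrite gee0_abs//.
  rewrite integral_nneseries//; last by move=> n w _; rewrite lee_fin.
  rewrite (le_lt_trans _ (ltry C))//; apply: lime_le; last exact: nearW.
  by apply: is_cvg_nneseries => n _ _; apply: integral_ge0 => w _; rewrite lee_fin.
have := integrable_ae measurableT intF.
apply: filterS => w /(_ Logic.I) Ffin.
apply: cvg_series_cvg_0.
apply: nondecreasing_is_cvgn.
  by apply/nondecreasing_seqP => n; rewrite /series/= big_nat_recr//= lerDl.
exists (fine (F w)) => _ [n _ <-].
rewrite -lee_fin fineK// /series/= -sumEFin.
by apply: nneseries_lim_ge => k _ _; rewrite lee_fin.
Qed.

(** * Deterministic estimates along dyadic subsequences *)

(** The nonzero terms form a geometric progression of ratio 1/2 whose first term is at most 1.
    Multiplied by [x], the bound controls the truncated squares [x ^+ 2 / n] summed over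
    [n = c * 2 ^ m]. *)
Lemma sum_dyadic_recip_le2 (R : realType) (N : nat) (c x : R) : 0 < c -> 0 <= x ->
  \sum_(0 <= m < N) (if x <= c * 2 ^+ m then x / (c * 2 ^+ m) else 0) <= 2.
Proof.
move=> + x0; elim: N c => [|N IH] c c0; first by rewrite big_nil.
(* If [c < x], the term [m = 0] vanishes and the remaining ones are the sum for [c * 2]. *)
have [xc|xc] := leP x c; last first.
  rewrite big_nat_recl// expr0 mulr1 (lt_geF xc) add0r.
  under eq_bigr do rewrite exprS mulrA.
  by apply: IH; rewrite mulr_gt0.
apply: (@le_trans _ _ (\sum_(0 <= m < N.+1) 2^-1 ^+ m)).
  apply: ler_sum => m _; case: ifPn => _; last by rewrite exprn_ge0.
  rewrite invfM mulrA exprVn ler_piMl// ?invr_ge0 ?exprn_ge0//.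
  by rewrite ler_pdivrMr// mul1r.
have -> : forall n, \sum_(0 <= m < n) 2^-1 ^+ m = 2 - 2 * 2^-1 ^+ n :> R.
  elim=> [|n IHn]; first by rewrite big_nil expr0 mulr1 subrr.
  by rewrite big_nat_recr//= IHn exprS; field.
by rewrite lerBlDr lerDl mulr_ge0// exprn_ge0.
Qed.

(** Each large [n] lies between [j * 2 ^ m] and [j.+1 * 2 ^ m] for some [j] in [[M, 2M)], with [M]
    depending only on the precision. Hence finitely many subsequences suffice, and monotonicity
    squeezes [s n] between them. *)
Lemma cvg_mean_dyadic (R : realType) (s : R^nat) (mu : R) :
    (forall n, 0 <= s n) -> {homo s : m n / (m <= n)%N >-> m <= n} ->
    (forall j, (0 < j)%N ->
      s (j * 2 ^ m)%N / (j * 2 ^ m)%:R @[m --> \oo] --> mu) ->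
  s n / n%:R @[n --> \oo] --> mu.
Proof.
move=> s0 sndecr smu; apply/cvgrPdist_le => e e0.
have mu0 : 0 <= mu.
  apply: (cvgr_to_ge (smu 1%N isT)); apply: nearW => m.
  by rewrite divr_ge0.
have e20 : 0 < e / 2 by rewrite divr_gt0.
(* [mu + e / 2] bounds the averages along the subsequences; replacing [n] by
   [j * 2 ^ m] or [j.+1 * 2 ^ m], [M <= j], costs a relative error [1 / M]. *)
have [M M0 Me] : exists2 M, (0 < M)%N & (mu + e / 2) / M%:R <= e / 2.
  exists (Num.bound ((e / 2)^-1 * (mu + e / 2))).+1 => //.
  rewrite ler_pdivrMr// -ler_pdivrMl//.
  rewrite ltW// (lt_le_trans (archi_boundP _)) ?ler_nat//.
  by rewrite mulr_ge0 ?invr_ge0 ?addr_ge0// ltW.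
(* The range includes [2M] because [j.+1] may reach it; being finite, it admits one threshold [m0]
   for all [j]. *)
have : \forall m \near \oo, forall j : 'I_(M.*2.+1), (0 < j)%N ->
    `|mu - s (j * 2 ^ m)%N / (j * 2 ^ m)%:R| <= e / 2.
  apply: filter_forall => j; have [->|j0] := posnP j; first exact: nearW.
  by move/cvgrPdist_le : (smu _ j0) => /(_ _ e20); apply: filterS.
move=> [m0 _ Hm0]; exists (M * 2 ^ m0)%N => // n /= Mn.
(* [m] is the largest exponent with [M * 2 ^ m <= n], which forces the quotient [j] into
   [[M, 2M)]. *)
pose m := trunc_log 2 (n %/ M); pose j := (n %/ 2 ^ m)%N.
have nM0 : (0 < n %/ M)%N by rewrite divn_gt0//; nia.
have m2 := trunc_log_bounds (isT : (1 < 2)%N) nM0.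
have m0m : (m0 <= m)%N.
  by apply: trunc_log_max => //; rewrite leq_divRL// mulnC.
have p2 : (0 < 2 ^ m)%N by rewrite expn_gt0.
have M2n : (M * 2 ^ m <= n)%N.
  by rewrite mulnC -leq_divRL//; case/andP: m2.
have nM2 : (n < M.*2 * 2 ^ m)%N.
  case/andP: m2 => _; rewrite -/m ltn_divLR// expnS.
  by rewrite -mul2n mulnAC.
have Mj : (M <= j)%N by rewrite leq_divRL.
have jM : (j < M.*2)%N by rewrite ltn_divLR.
have j0 : (0 < j)%N by exact: leq_trans Mj.
have jn : (j * 2 ^ m <= n)%N by exact: leq_divM.
have nj : (n <= j.+1 * 2 ^ m)%N by rewrite ltnW// ltn_ceil.
have near_mu i : (M <= i <= M.*2)%N ->
    exists2 A : R, `|mu - A| <= e / 2 & s (i * 2 ^ m)%N = A * (i%:R * (2 ^ m)%:R).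
  move=> /andP[Mi iM]; exists (s (i * 2 ^ m)%N / (i * 2 ^ m)%:R).
    by have := Hm0 _ m0m (inord i); rewrite inordK//; apply; exact: leq_trans Mi.
  by rewrite natrM divfK// mulf_neq0// pnatr_eq0 -lt0n// (leq_trans _ Mi).
have /near_mu[A1 A1mu sA1] : (M <= j <= M.*2)%N by rewrite Mj ltnW.
have /near_mu[A2 A2mu sA2] : (M <= j.+1 <= M.*2)%N by rewrite jM leqW.
have := sndecr _ _ jn; rewrite sA1 => {sA1} S1.
have := sndecr _ _ nj; rewrite sA2 => {sA2} S2.
have {A1mu} /andP[A1l A1u] : mu - e / 2 <= A1 <= mu + e / 2 by rewrite -ler_distlC.
have {A2mu} /andP[A2l A2u] : mu - e / 2 <= A2 <= mu + e / 2 by rewrite -ler_distlC.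
have {}jn : j%:R * (2 ^ m)%:R <= n%:R :> R by rewrite -natrM ler_nat.
have {}nj : n%:R <= (j%:R + 1) * (2 ^ m)%:R :> R by rewrite natr1 -natrM ler_nat.
move: S1 S2; rewrite -[in j.+1%:R]natr1 => S1 S2.
have {}j0 : 0 < j%:R :> R by rewrite ltr0n.
have {}p2 : 0 < (2 ^ m)%:R :> R by rewrite ltr0n.
(* This pays for passing from [j] to [j + 1]: it gives [(mu + e / 2) * (j + 1) <= (mu + e) * j] and
   [(mu - e) * (j + 1) <= (mu - e / 2) * j]. *)
have {Me} Me : mu + e / 2 <= e / 2 * j%:R.
  move: Me; rewrite ler_pdivrMr ?ltr0n// => /le_trans; apply.
  by rewrite ler_wpM2l ?ler_nat// ltW.
move: (2 ^ m)%:R p2 j%:R j0 jn nj S1 S2 Me => p p0 q q0 qn nq S1 S2 Me.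
have n0 : 0 < n%:R :> R by apply: lt_le_trans qn; rewrite mulr_gt0.
rewrite ler_distlC; apply/andP; split.
  rewrite ler_pdivlMr//.
  (* Multiplying [n <= (q + 1) * p] by [mu - e] needs a nonnegative factor; otherwise [0 <= s n]
     already gives the bound. *)
  have [me|me] := leP (mu - e) 0.
    by rewrite (le_trans _ (s0 n))// mulr_le0_ge0// ltW.
  apply: le_trans S1; apply: (@le_trans _ _ ((mu - e) * ((q + 1) * p))).
    by rewrite ler_wpM2l// ltW.
  by rewrite !mulrA ler_wpM2r ?(ltW p0)//; nra.
rewrite ler_pdivrMr//; apply: (le_trans S2).
apply: (@le_trans _ _ ((mu + e) * (q * p))); last by rewrite ler_wpM2l// addr_ge0// ltW.
by rewrite !mulrA ler_wpM2r ?(ltW p0)//; nra.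
Qed.

(** * Consequences of independence and of equal laws *)

(** The law of [(X, Y)] agrees with the product of the two laws on rectangles, hence everywhere by
    uniqueness of the product measure; Tonelli then factorises the integral. *)
Lemma ge0_integralM_independent d (T : measurableType d) (R : realType)
    (P : probability T R) (X Y : {RV P >-> R}) (f g : R -> R) :
    (forall A B : set R, measurable A -> measurable B ->
      P ((X @^-1` A) `&` (Y @^-1` B)) = (P (X @^-1` A) * P (Y @^-1` B))%E) ->
    measurable_fun setT f -> measurable_fun setT g ->
    (forall x, 0 <= f x) -> (forall x, 0 <= g x) ->
  (\int[P]_w (f (X w) * g (Y w))%:E =
   (\int[P]_w (f (X w))%:E) * \int[P]_w (g (Y w))%:E)%E.
Proof.
move=> XY mf mg f0 g0.
pose Z w : R * R := (X w, Y w).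
have mZ : measurable_fun setT Z by apply: measurable_fun_pair.
pose ZM := HB.pack_for {mfun T >-> (R * R)%type} Z (isMeasurableFun.Build _ _ _ _ Z mZ).
pose h (z : R * R) := (f z.1 * g z.2)%:E.
have mh : measurable_fun setT h.
  apply/measurable_EFinP; apply: measurable_funM; apply: measurableT_comp => //.
have h0 z : (0 <= h z)%E by rewrite lee_fin mulr_ge0.
transitivity (\int[distribution P ZM]_z h z)%E.
  by rewrite ge0_integral_distribution.
rewrite (eq_measure_integral (distribution P X \x distribution P Y)%E); last first.
  move=> A mA _; symmetry; exact: product_measure_unique.
rewrite fubini_tonelli1// /fubini_F.
have mEf : measurable_fun setT (EFin \o f) by exact/measurable_EFinP.
have mEg : measurable_fun setT (EFin \o g) by exact/measurable_EFinP.
rewrite [LHS](_ : _ = \int[distribution P X]_x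
    ((f x)%:E * \int[distribution P Y]_y (g y)%:E))%E; last first.
  apply: eq_integral => x _; rewrite /h/= -ge0_integralZl ?lee_fin//.
  by move=> y _; rewrite lee_fin.
rewrite /= ge0_integralZr//; last 2 first.
  by move=> x _; rewrite lee_fin.
  by apply: integral_ge0 => y _; rewrite lee_fin.
by rewrite !ge0_integral_distribution// => x; rewrite lee_fin.
Qed.

Lemma pairwise_independent_comp d (T : measurableType d) (R : realType)
    (P : probability T R) (X Y : nat -> {RV P >-> R}) (g : R -> R) :
    measurable_fun setT g -> (forall i, Y i =1 g \o X i) ->
  pairwise_independent X -> pairwise_independent Y.
Proof.
move=> mg YX indX i j ij A B mA mB.
have YXE k C : Y k @^-1` C = X k @^-1` (g @^-1` C).
  by apply/seteqP; split=> w; rewrite /preimage/= YX.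
rewrite !YXE.
by apply: indX => //; rewrite -[X in measurable X]setTI; apply: mg.
Qed.

Lemma identically_distributed_comp d (T : measurableType d) (R : realType)
    (P : probability T R) (X Y : nat -> {RV P >-> R}) (g : R -> R) :
    measurable_fun setT g -> (forall i, Y i =1 g \o X i) ->
  identically_distributed X -> identically_distributed Y.
Proof.
move=> mg YX idX i j A mA.
have YXE k : distribution P (Y k) A = distribution P (X k) (g @^-1` A).
  by congr (P _); apply/seteqP; split=> w; rewrite /preimage/= YX.
rewrite !YXE.
by apply: idX; rewrite -[X in measurable X]setTI; apply: mg.
Qed.

Lemma integral_identically_distributed d (T : measurableType d) (R : realType)
    (P : probability T R) (X : nat -> {RV P >-> R}) (f : R -> R) i :
    identically_distributed X -> measurable_fun setT f -> (forall x, 0 <= f x) ->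
  (\int[P]_w (f (X i w))%:E = \int[P]_w (f (X 0%N w))%:E)%E.
Proof.
move=> idX mf f0.
have mEf : measurable_fun setT (EFin \o f) by exact/measurable_EFinP.
have E j : (\int[P]_w (f (X j w))%:E = \int[distribution P (X j)]_x (f x)%:E)%E.
  by rewrite (@ge0_integral_distribution _ _ _ _ _ _ (X j) (EFin \o f))// => x;
    rewrite lee_fin.
by rewrite !E; apply: eq_measure_integral => A mA _; exact: idX.
Qed.

(** * Square integrability, averages and variances of sums *)

Lemma bounded_Lfun2 d (T : measurableType d) (R : realType)
    (P : probability T R) (X : T -> R) (c : R) :
    measurable_fun setT X -> (forall w, 0 <= X w <= c) -> X \in Lfun P 2%:E.
Proof.
move=> mX Xc; rewrite inE; apply/andP; split; rewrite inE//=.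
have mXp : measurable_fun setT (fun w => `|X w| `^ 2).
  apply: (measurableT_comp (measurable_powR _)).
  exact: measurableT_comp.
rewrite /finite_norm unlock poweR_lty//=.
apply: (@le_lt_trans _ _ (\int[P]_w (cst (c `^ 2)%:E w))%E); last first.
  by rewrite integral_cst// ltey_eq fin_numM ?fin_num_measure.
apply: ge0_le_integral => //.
  by apply/measurable_EFinP.
move=> w _; have /andP[X0 Xc'] := Xc w.
by rewrite lee_fin ge0_ler_powR ?nnegrE ?ger0_norm// (le_trans X0).
Qed.

(** Cesàro's theorem; the shift makes the denominators [n.+1]. *)
Lemma cvg_average (R : realType) (u : R^nat) (l : R) : u n @[n --> \oo] --> l ->
  (\sum_(0 <= i < n) u i) / n%:R @[n --> \oo] --> l.
Proof.
move=> /cesaro ul; rewrite -cvg_shiftS.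
by under eq_fun do rewrite /= mulrC.
Qed.

Section uncorrelated.
Context d (T : measurableType d) (R : realType) (P : probability T R).
Variable Z : nat -> T -> R.
Hypothesis Z2 : forall i, Z i \in Lfun P 2%:E.

Lemma Lfun2_sum n : (fun w => \sum_(0 <= i < n) Z i w) \in Lfun P 2%:E.
Proof.
elim: n => [|n IH].
  rewrite [X in X \in _](_ : _ = cst 0) ?Lfun_cst//.
  by apply/funext => w; rewrite big_nil.
rewrite [X in X \in _](_ : _ = (fun w => \sum_(0 <= i < n) Z i w) + Z n).
  by rewrite rpredD ?lee1n.
by apply/funext => w; rewrite big_nat_recr.
Qed.

Lemma variance_sum_uncorrelated n :
    (forall i j, i <> j -> covariance P (Z i) (Z j) = 0%E) ->
  ('V_P[fun w => (\sum_(0 <= i < n) Z i w)%R] = \sum_(0 <= i < n) 'V_P[Z i])%E.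
Proof.
move=> Zcov.
have sumS k : (fun w => \sum_(0 <= i < k.+1) Z i w) =
    (fun w => \sum_(0 <= i < k) Z i w) \+ Z k.
  by apply/funext => w; rewrite big_nat_recr.
have sum0 : (fun w => \sum_(0 <= i < 0) Z i w) = cst 0.
  by apply/funext => w; rewrite big_nil.
(* The condition [k <= j] keeps [Z j] out of the sum, so bilinearity only meets covariances of
   distinct indices. *)
have cov k j : (k <= j)%N ->
    covariance P (fun w => \sum_(0 <= i < k) Z i w) (Z j) = 0%E.
  elim: k => [|k IH] kj; first by rewrite sum0 covariance_cst_l.
  rewrite sumS covarianceDl ?Lfun2_sum// IH 1?ltnW// Zcov ?adde0//.
  by move=> kj'; rewrite kj' ltnn in kj.
elim: n => [|n IH]; first by rewrite sum0 variance_cst big_nil.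
by rewrite sumS varianceD ?Lfun2_sum// IH cov// mule0 adde0 big_nat_recr.
Qed.

End uncorrelated.

Lemma variance_le_integral_sqr d (T : measurableType d) (R : realType)
    (P : probability T R) (X : T -> R) : X \in Lfun P 2%:E ->
  ('V_P[X] <= \int[P]_w (X w ^+ 2)%:E)%E.
Proof.
move=> X2; rewrite varianceE//.
have [e ->] : exists e, 'E_P[X]%E = e%:E.
  exists (fine 'E_P[X]%E); rewrite fineK// expectation_fin_num//.
  by apply: Lfun_subset12 X2; rewrite fin_num_measure.
by rewrite unlock leeBlDr// leeDl// -EFin_expe lee_fin sqr_ge0.
Qed.

(** * Truncation of nonnegative values *)

(** Values above [c] go to 0 and not to [c], so that for every [x] the quotient
    [truncation c x ^+ 2 / c] is [x] times a summand of [sum_dyadic_recip_le2]. *)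
Definition truncation (R : realType) (c x : R) : R := if x <= c then x else 0.

Lemma measurable_truncation (R : realType) (c : R) :
  measurable_fun setT (truncation c).
Proof.
apply: measurable_fun_if => //; exact: measurable_fun_ler.
Qed.

Lemma truncation_bounds (R : realType) (c x : R) : 0 <= c -> 0 <= x ->
  0 <= truncation c x <= c.
Proof.
move=> c0 x0; rewrite /truncation.
by case: ifPn => [->|_]; rewrite ?x0 ?lexx ?c0.
Qed.

Lemma le_truncation (R : realType) (b c x : R) : b <= c -> 0 <= x ->
  truncation b x <= truncation c x.
Proof.
move=> bc x0; rewrite /truncation; case: ifPn => [xb|_].
  by rewrite (le_trans xb bc).
by case: ifPn.
Qed.

(** * Etemadi's strong law for nonnegative variables *)

Section pairwise_independent_nonneg.
Context d (T : measurableType d) (R : realType) (P : probability T R).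
Variable Y : nat -> {RV P >-> R}.
Hypothesis Y0 : forall i w, 0 <= Y i w.
Hypothesis indY : pairwise_independent Y.
Hypothesis idY : identically_distributed Y.

Let Z i w := truncation i%:R (Y i w).

Let mZ i : measurable_fun setT (Z i).
Proof. by apply: measurableT_comp => //; exact: measurable_truncation. Qed.

Let Z_bounds i w : 0 <= Z i w <= i%:R.
Proof. exact: truncation_bounds. Qed.

Let Z2 i : Z i \in Lfun P 2%:E.
Proof. exact: bounded_Lfun2. Qed.

Let Z1 i : Z i \in Lfun P 1%:E.
Proof. by apply: Lfun_subset12 (Z2 i); rewrite fin_num_measure. Qed.

Let covZ i j : i <> j -> covariance P (Z i) (Z j) = 0%E.
Proof.
move=> ij; rewrite covarianceE ?Z1//; last exact: Lfun2_mul_Lfun1.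
(* The product formula wants functions that are nonnegative on the whole line; as [Y] is
   nonnegative, the absolute value leaves [Z] unchanged. *)
have absZ k w : `|truncation k%:R (Y k w)| = Z k w.
  by rewrite ger0_norm//; case/andP: (Z_bounds k w).
have mtr k : measurable_fun setT (fun x : R => `|truncation k%:R x|).
  by apply: measurableT_comp => //; exact: measurable_truncation.
have := ge0_integralM_independent (indY ij) (mtr i) (mtr j)
  (fun=> normr_ge0 _) (fun=> normr_ge0 _).
under eq_integral do rewrite !absZ.
under [X in (_ = X * _)%E -> _]eq_integral do rewrite absZ.
under [X in (_ = _ * X)%E -> _]eq_integral do rewrite absZ.
move=> E.
have -> : 'E_P[(Z i * Z j)%R]%E = ('E_P[Z i] * 'E_P[Z j])%E by rewrite !unlock.
by rewrite subee// fin_numM ?expectation_fin_num.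
Qed.

Let S n w := \sum_(0 <= i < n) Z i w.

(** Variances add up. Each is at most a second moment, which by equal laws and monotonicity in the
    truncation level is at most that of [Y 0] truncated at [k]. *)
Let V_S k : ('V_P[S k] <= k%:R%:E * \int[P]_w (truncation k%:R (Y 0%N w) ^+ 2)%:E)%E.
Proof.
rewrite variance_sum_uncorrelated//.
have mtr2 c : measurable_fun setT (fun x : R => truncation c x ^+ 2).
  by apply: measurable_funX; exact: measurable_truncation.
apply: (@le_trans _ _ (\sum_(0 <= i < k) \int[P]_w (truncation k%:R (Y 0%N w) ^+ 2)%:E)%E).
  rewrite !big_nat; apply: lee_sum => i /= ik.
  apply: (le_trans (variance_le_integral_sqr (Z2 i))).
  rewrite (integral_identically_distributed i idY (mtr2 i%:R))//; last first.
    by move=> x; rewrite sqr_ge0.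
  apply: ge0_le_integral => //.
  - by move=> w _; rewrite lee_fin sqr_ge0.
  - by apply/measurable_EFinP; exact: (measurableT_comp (mtr2 _)).
  - by apply/measurable_EFinP; exact: (measurableT_comp (mtr2 _)).
  move=> w _; rewrite lee_fin lerXn2r ?nnegrE//.
  - by case/andP: (@truncation_bounds R i%:R _ (ler0n _ _) (Y0 0%N w)).
  - by case/andP: (@truncation_bounds R k%:R _ (ler0n _ _) (Y0 0%N w)).
  - by rewrite le_truncation// ler_nat ltnW.
by rewrite sumr_const_nat subn0 mule_natl.
Qed.

Hypothesis intY : (\int[P]_w (Y 0%N w)%:E < +oo)%E.

Let mu : R := fine (\int[P]_w (Y 0%N w)%:E)%E.

Let muE : (\int[P]_w (Y 0%N w)%:E = mu%:E)%E.
Proof. by rewrite fineK// ge0_fin_numE// integral_ge0// => w _; rewrite lee_fin. Qed.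

Let mEY i : measurable_fun setT (EFin \o Y i).
Proof. exact/measurable_EFinP. Qed.

(** With [k = j * 2 ^ m], the squared average has integral ['V_P[S k] / k ^+ 2], at most the
    integral of [h m]. Pointwise the [h m] sum to at most [2 * Y 0], so these integrals sum to at
    most [2 * mu]. *)
Let cvg_centered j : (0 < j)%N -> {ae P, forall w,
  (S (j * 2 ^ m)%N w - fine 'E_P[S (j * 2 ^ m)%N]%E) / (j * 2 ^ m)%:R
    @[m --> \oo] --> 0}.
Proof.
move=> j0; pose k m := (j * 2 ^ m)%N.
have k0 m : 0 < (k m)%:R :> R by rewrite ltr0n muln_gt0 j0 expn_gt0.
pose c m : R := fine 'E_P[S (k m)]%E.
pose X m w := ((S (k m) w - c m) / (k m)%:R) ^+ 2.
pose h m w := truncation (k m)%:R (Y 0%N w) ^+ 2 / (k m)%:R.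
have mS n : measurable_fun setT (S n) by exact: measurable_sum.
have mB m : measurable_fun setT (fun w => S (k m) w - c m) by exact: measurable_funB.
have mX m : measurable_fun setT (X m).
  by apply: measurable_funX; apply: measurable_funM.
have mtr m : measurable_fun setT (fun w => truncation (k m)%:R (Y 0%N w) ^+ 2).
  by apply: measurable_funX; apply: measurableT_comp => //; exact: measurable_truncation.
have mh m : measurable_fun setT (EFin \o h m).
  by apply/measurable_EFinP; apply: measurable_funM.
have h0 m w : 0 <= h m w by rewrite divr_ge0// sqr_ge0.
have XV m : (\int[P]_w (X m w)%:E <= \int[P]_w (h m w)%:E)%E.
  have -> : (\int[P]_w (X m w)%:E = 'V_P[S (k m)] * ((k m)%:R ^- 2)%:E)%E.
    have -> : ('V_P[S (k m)] = \int[P]_w ((S (k m) w - c m) ^+ 2)%:E)%E.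
      rewrite /variance 2!unlock; apply: eq_integral => w _.
      by rewrite expr2 /c unlock.
    rewrite -ge0_integralZr//.
    - by apply: eq_integral => w _; rewrite -EFinM /X exprMn exprVn.
    - by apply/measurable_EFinP; exact: measurable_funX.
    - by move=> w _; rewrite lee_fin sqr_ge0.
  have -> : (\int[P]_w (h m w)%:E =
      (\int[P]_w (truncation (k m)%:R (Y 0%N w) ^+ 2)%:E) * ((k m)%:R^-1)%:E)%E.
    rewrite -ge0_integralZr//.
    - exact/measurable_EFinP.
    - by move=> w _; rewrite lee_fin sqr_ge0.
  apply: (@le_trans _ _ ((k m)%:R%:E * (\int[P]_w (truncation (k m)%:R (Y 0%N w) ^+ 2)%:E)
      * ((k m)%:R ^- 2)%:E)%E).
    by rewrite lee_wpmul2r// lee_fin invr_ge0 sqr_ge0.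
  rewrite muleC muleA -EFinM muleC expr2 invfM -mulrA mulVf ?mulr1//.
  by rewrite gt_eqF.
have Xsum N : (\sum_(0 <= m < N) \int[P]_w (X m w)%:E <= (2 * mu)%:E)%E.
  apply: (@le_trans _ _ (\sum_(0 <= m < N) \int[P]_w (h m w)%:E)%E).
    exact: lee_sum.
  rewrite -ge0_integral_sum//; last by move=> m w _; rewrite lee_fin.
  rewrite EFinM -muE -ge0_integralZl//; last 2 first.
  - exact: mEY.
  - by move=> w _; rewrite lee_fin.
  apply: ge0_le_integral => //.
  - by move=> w _; apply: sume_ge0 => m _; rewrite lee_fin.
  - by apply: emeasurable_sum.
  - by apply: (@emeasurable_funM _ _ _ _ (cst 2%:E) (EFin \o Y 0%N)) => //;
    exact: measurable_cst.
  move=> w _; rewrite sumEFin -EFinM lee_fin.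
  rewrite [leRHS]mulrC.
  have jR : 0 < j%:R :> R by rewrite ltr0n.
  (* The dyadic estimate with [c = j] and [x = Y 0 w], multiplied by [x]. *)
  apply: le_trans (ler_wpM2l (Y0 0%N w) (sum_dyadic_recip_le2 N jR (Y0 0%N w))).
  rewrite mulr_sumr le_eqVlt; apply/orP; left; apply/eqP.
  apply: eq_bigr => m _; rewrite /h /truncation /k natrM natrX.
  by case: ifPn => _; [rewrite expr2 mulrA | rewrite mulr0 expr0n mul0r].
have := ae_cvg0_bounded_series mX (fun m w => sqr_ge0 _) Xsum.
apply: filterS => w Xw; apply: norm_cvg0.
rewrite (_ : (fun _ => _) = fun m => Num.sqrt (X m w)); last first.
  by apply/funext => m; rewrite /= sqrtr_sqr.
by rewrite -(@sqrtr0 R); exact: (cvg_comp _ _ Xw (@sqrt_continuous R 0)).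
Qed.

Let integral_Z i : (\int[P]_w (Z i w)%:E = \int[P]_w (truncation i%:R (Y 0%N w))%:E)%E.
Proof.
have trY k w : `|truncation i%:R (Y k w)| = truncation i%:R (Y k w).
  by rewrite ger0_norm//; case/andP: (@truncation_bounds R i%:R _ (ler0n _ _) (Y0 k w)).
have mtr : measurable_fun setT (fun x : R => `|truncation i%:R x|).
  by apply: measurableT_comp => //; exact: measurable_truncation.
have := integral_identically_distributed i idY mtr (fun=> normr_ge0 _).
under eq_integral do rewrite trY.
by under [in X in _ = X -> _]eq_integral do rewrite trY.
Qed.

(** Dominated convergence, with [Y 0] as dominating function, sends the integral of [Z n] to [mu];
    averaging preserves the limit. *)
Let cvg_mean_S : fine 'E_P[S n]%E / n%:R @[n --> \oo] --> mu.
Proof.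
have cvgZ : fine (\int[P]_w (Z n w)%:E)%E @[n --> \oo] --> mu.
  apply: fine_cvg; rewrite -muE (eq_cvg _ _ integral_Z).
  have [|||||_ _] := @dominated_convergence _ _ _ P setT measurableT
      (fun n w => (truncation n%:R (Y 0%N w))%:E) (EFin \o Y 0%N) (EFin \o Y 0%N) => //.
  - move=> n; apply/measurable_EFinP; apply: measurableT_comp => //.
    exact: measurable_truncation.
  - apply: aeW => w _; apply: cvg_near_cst; near=> n.
    rewrite /truncation ifT//; near: n; exact: nbhs_infty_ger.
  - apply/integrableP; split=> //.
    by under eq_integral do rewrite gee0_abs ?lee_fin//.
  apply: aeW => w n _; have /andP[t0 _] := @truncation_bounds R n%:R _ (ler0n _ _) (Y0 0%N w).
  rewrite gee0_abs ?lee_fin//= /truncation.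
  by case: ifPn.
have ES n : fine 'E_P[S n]%E = \sum_(0 <= i < n) fine (\int[P]_w (Z i w)%:E)%E.
  rewrite unlock; under eq_integral do rewrite -sumEFin.
  rewrite ge0_integral_sum//; last 2 first.
  - by move=> i; exact/measurable_EFinP.
  - by move=> i w _; rewrite lee_fin; case/andP: (Z_bounds i w).
  rewrite -[RHS]/(fine (_%:E)) -sumEFin; congr fine; apply: eq_bigr => i _.
  rewrite fineK//; have := expectation_fin_num (Z1 i); by rewrite unlock.
by under eq_fun do rewrite ES; exact: cvg_average.
Unshelve. all: by end_near. Qed.

(** [Y n] and [Z n] differ exactly when [n < Y n]. By equal laws the probabilities of these events
    sum to at most [mu + 1], so almost surely only finitely many occur. *)
Let ae_truncation : {ae P, forall w, Y n w - Z n w @[n --> \oo] --> 0}.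
Proof.
pose f n : R -> R := \1_(`]n%:R, +oo[%classic).
have mf n : measurable_fun setT (f n) by exact: measurable_indic.
have mfY n k : measurable_fun setT (f n \o Y k) by exact: measurableT_comp.
have f0 n x : 0 <= f n x by rewrite /f indicE.
have fE n x : f n x = (n%:R < x)%R%:R.
  by rewrite /f indicE mem_setE in_itv/= andbT.
(* At most [x + 1] natural numbers lie strictly below [x]. *)
have fsum N x : 0 <= x -> \sum_(0 <= n < N) f n x <= x + 1.
  move=> x0; elim: N => [|N IH]; first by rewrite big_nil addr_ge0.
  rewrite big_nat_recr//= fE; have [Nx|xN] := ltP; last by rewrite addr0.
  apply: lerD => //; apply: le_trans (ltW Nx).
  rewrite -[N in leRHS]subn0 -sumr_const_nat; apply: ler_sum => n _.
  by rewrite fE; case: (_ < _).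
have mEfY n : measurable_fun setT (EFin \o (f n \o Y 0%N)) by exact/measurable_EFinP.
have Xsum N : (\sum_(0 <= n < N) \int[P]_w ((f n \o Y n) w)%:E <= (mu + 1)%:E)%E.
  under eq_bigr => n _ do rewrite (integral_identically_distributed n idY (mf n) (f0 n)).
  rewrite -ge0_integral_sum//; last by move=> n w _; rewrite lee_fin.
  have -> : ((mu + 1)%:E = \int[P]_w ((EFin \o Y 0%N) w + cst 1%:E w))%E.
    rewrite ge0_integralD//; last by move=> w _; rewrite lee_fin.
    rewrite integral_cst// mul1e [X in (_ + X)%E]probability_setT.
    by rewrite muE.
  apply: ge0_le_integral => //.
  - by move=> w _; apply: sume_ge0 => m _; rewrite lee_fin.
  - by apply: emeasurable_sum.
  - by apply: emeasurable_funD.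
  by move=> w _; rewrite sumEFin /= -EFinD lee_fin fsum.
have := ae_cvg0_bounded_series (fun n => mfY n n) (fun n w => f0 n _) Xsum.
(* An indicator at distance less than 1 from 0 is 0, so convergence to 0 means being eventually
   0. *)
apply: filterS => w /cvgrPdist_lt/(_ _ ltr01) fw.
apply: cvg_near_cst; apply: filterS fw => n /=.
rewrite sub0r normrN fE /Z /truncation; case: (ltP n%:R (Y n w)) => _.
  by rewrite normr1 ltxx.
by rewrite subrr.
Qed.

Lemma slln_pairwise_independent_nonneg : {ae P, forall w,
  (\sum_(0 <= i < n) Y i w) / n%:R @[n --> \oo] --> fine (\int[P]_w (Y 0%N w)%:E)%E}.
Proof.
have cvgc : {ae P, forall w, forall j, (0 < j)%N ->
    (S (j * 2 ^ m)%N w - fine 'E_P[S (j * 2 ^ m)%N]%E) / (j * 2 ^ m)%:R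
      @[m --> \oo] --> 0}.
  apply: ae_foralln => j; have [->|j0] := posnP j; first exact: aeW.
  by apply: filterS (cvg_centered j0).
apply: filterS2 cvgc ae_truncation => w Sw YZw.
apply: cvg_mean_dyadic => [n|m n mn|j j0].
- by apply: sumr_ge0 => i _.
- by rewrite (@big_cat_nat _ _ _ m 0 n)//= lerDl sumr_ge0.
have jy : (j * 2 ^ m)%N @[m --> \oo] --> \oo.
  apply/cvgnyPge => A; exists A => // m /= Am.
  rewrite (leq_trans Am)// (leq_trans (ltnW (ltn_expl m (isT : (1 < 2)%N))))//.
  by rewrite leq_pmull.
(* The average of [Y] splits into the centred average of [Z], the mean expectation and the average
   of [Y - Z], with limits 0, [mu] and 0. *)
have := cvgD (cvgD (Sw j j0) (cvg_comp _ _ jy cvg_mean_S))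
  (cvg_comp _ _ jy (cvg_average YZw)).
rewrite add0r addr0 => cvgsum; apply: (cvg_trans _ (cvgsum _ _)).
apply: near_eq_cvg; apply: nearW => m /=.
rewrite !fctE/= -!mulrDl; congr (_ / _).
by rewrite sumrB subrK addrC subrK.
Qed.

End pairwise_independent_nonneg.

(** * Strong law for integrable functions of the variables *)

(** The positive and negative parts of [g] are again functions of each [X i], so they inherit
    pairwise independence and equal laws; the nonnegative case applies to both, and the limits are
    subtracted. *)
Lemma slln_pairwise_independent d (T : measurableType d) (R : realType)
    (P : probability T R) (X : nat -> {RV P >-> R}) (g : R -> R) :
    pairwise_independent X -> identically_distributed X ->
    measurable_fun setT g -> P.-integrable setT (EFin \o (g \o X 0%N)) ->
  {ae P, forall w, (\sum_(0 <= i < n) g (X i w)) / n%:R @[n --> \oo] -->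
    fine (\int[P]_w (g (X 0%N w))%:E)%E}.
Proof.
move=> indX idX mg intg.
have slln_ge0 (h : R -> R) : measurable_fun setT h -> (forall x, 0 <= h x <= `|g x|) ->
    P.-integrable setT (EFin \o (h \o X 0%N)) /\
    {ae P, forall w, (\sum_(0 <= i < n) h (X i w)) / n%:R @[n --> \oo] -->
      fine (\int[P]_w (h (X 0%N w))%:E)%E}.
  move=> mh hg.
  have inth : P.-integrable setT (EFin \o (h \o X 0%N)).
    apply: le_integrable intg => //.
      by apply/measurable_EFinP; exact: measurableT_comp.
    move=> w _; rewrite /= lee_fin.
    by have /andP[h0 hg'] := hg (X 0%N w); rewrite ger0_norm.
  split => //.
  have mhX i : measurable_fun setT (h \o X i) by exact: measurableT_comp.
  pose Y i : {RV P >-> R} := HB.pack_for {mfun T >-> R} (h \o X i)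
    (isMeasurableFun.Build _ _ _ _ (h \o X i) (mhX i)).
  apply: (@slln_pairwise_independent_nonneg _ _ _ P Y).
  - by move=> i w; case/andP: (hg (X i w)).
  - by apply: (pairwise_independent_comp mh _ indX).
  - by apply: (identically_distributed_comp mh _ idX).
  have /integrableP[_] := inth; apply: le_lt_trans.
  rewrite le_eqVlt; apply/orP; left; apply/eqP; apply: eq_integral => w _.
  by rewrite /= ger0_norm//; case/andP: (hg (X 0%N w)).
pose gp x := Num.max (g x) 0; pose gn x := Num.max (- g x) 0.
have gE x : g x = gp x - gn x.
  rewrite /gp /gn; have /orP[g0|g0] := le_total 0 (g x).
    by rewrite max_l// max_r ?oppr_le0// subr0.
  by rewrite max_r// max_l ?oppr_ge0// sub0r opprK.
have [|x|intp cvgp] := slln_ge0 gp.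
- exact: measurable_maxr.
- by rewrite le_max lexx orbT ge_max ler_norm normr_ge0.
have [|x|intn cvgn] := slln_ge0 gn.
- by apply: measurable_maxr => //; exact: measurableT_comp.
- by rewrite le_max lexx orbT ge_max -normrN ler_norm normr_ge0.
apply: filterS2 cvgp cvgn => w cvgp cvgn.
have -> : (\int[P]_w (g (X 0%N w))%:E =
    \int[P]_w (gp (X 0%N w))%:E - \int[P]_w (gn (X 0%N w))%:E)%E.
  rewrite -integralB_EFin//; apply: eq_integral => v _.
  by rewrite /= -EFinB -gE.
rewrite fineB ?integrable_fin_num//.
apply: (cvg_trans _ (cvgB cvgp cvgn)); apply: near_eq_cvg; apply: nearW => n.
rewrite !fctE -mulrBl -sumrB; congr (_ / _).
by apply: eq_bigr => i _; rewrite gE.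
Qed.

(** * Localisation and convergence of deviation means *)

(** The intermediate value theorem yields a zero in [[s, t]], so [get] returns a genuine zero.
    Monotonicity of the sum in its last argument and the strict signs at [s] and [t] then exclude
    any zero outside the open interval. *)
Lemma deviation_mean_between (R : realType) (I : set R) (D : R -> R -> R) n
    (x : 'I_n -> R) (s t : R) : is_interval I -> deviation I D ->
    (forall i, I (x i)) -> I s -> I t -> s <= t ->
    0 < \sum_(i < n) D (x i) s -> \sum_(i < n) D (x i) t < 0 ->
  s < deviation_mean I D x < t.
Proof.
move=> itvI [decrD contD _] Ix Is It st Ds Dt.
pose F u := \sum_(i < n) D (x i) u.
have decrF u v : I u -> I v -> u <= v -> F v <= F u.
  move=> Iu Iv; rewrite le_eqVlt => /predU1P[->//|uv].
  by apply: ler_sum => i _; apply: ltW; exact: decrD.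
have stI : `[s, t] `<=` I.
  move=> u /=; rewrite in_itv/=; exact: itvI.
have contF : {within `[s, t], continuous F}.
  apply: (continuous_subspaceW stI).
  rewrite (_ : F = \sum_(i < n) D (x i)); last first.
    by apply/funext => u; rewrite fct_sumE.
  elim/big_ind: _ => [u|f g cf cg u|i _]; last exact: contD.
    exact: cvg_cst.
  exact: cvgD (cf u) (cg u).
have [|c cst Fc] := IVT (v := 0) st contF.
  by rewrite ge_min le_max (ltW Ds) (ltW Dt) orbT.
have [IM FM] : [set t | I t /\ F t = 0] (deviation_mean I D x).
  by apply: getPex; exists c; split => //; exact: stI.
rewrite !ltNge; apply/andP; split; apply/negP => h.
  by have := decrF _ _ IM Is h; rewrite FM leNgt Ds.
by have := decrF _ _ It IM h; rewrite FM leNgt Dt.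
Qed.

(** A zero integral would make [f] vanish almost everywhere, contradicting positivity because a
    probability measure is not zero. *)
Lemma integral_gt0 d (T : measurableType d) (R : realType) (P : probability T R)
    (f : T -> R) : measurable_fun setT f -> (forall w, 0 <= f w) ->
  {ae P, forall w, 0 < f w} -> (0 < \int[P]_w (f w)%:E)%E.
Proof.
move=> mf f0 fgt0.
have mEf : measurable_fun setT (EFin \o f) by exact/measurable_EFinP.
rewrite lt0e integral_ge0 ?andbT//; last by move=> w _; rewrite lee_fin.
apply/negP => /eqP int0.
have /(ae_eq_integral_abs P measurableT mEf) : (\int[P]_w `|(EFin \o f) w| = 0)%E.
  by rewrite -[RHS]int0; apply: eq_integral => w _; rewrite gee0_abs ?lee_fin.
move=> ae0.
have Pgt0 : (0%R < P setT)%E by rewrite probability_setT.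
have PF := ae_properfilter_algebraOfSetsType Pgt0.
suff /filter_ex[] : \forall w \ae P, False by [].
by apply: filterS2 ae0 fgt0 => w /(_ Logic.I) [->]; rewrite ltxx.
Qed.

Theorem theorem3p1 (d : measure_display) (T : measurableType d) (R : realType)
    (P : probability T R) (I : set R) (D : R -> R -> R)
    (xi : nat -> {RV P >-> R})
    (hI : nondegenerate_interval I)
    (hD : deviation I D)
    (hindep : pairwise_independent xi)
    (hid : identically_distributed xi)
    (hborel : borel_fst I D)
    (hxiI : P (xi 0%N @^-1` I) = 1%E)
    (hint : interior_point_condition I D (xi 0%N)) :
  {ae P, forall w,
    deviation_mean I D (fun i : 'I_n.+1 => xi i w) @[n --> \oo]
      --> deviation_mean_rv I D (xi 0%N)}.
Proof.
have [itvI _] := hI; have [decrD _ _] := hD.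
have mI : measurable I by exact: is_interval_measurable.
(* Equal laws carry [hxiI] from index 0 to every index, and countably many null sets are united. *)
have aeI : {ae P, forall w, forall i, I (xi i w)}.
  apply: ae_foralln => i; exists (~` (xi i @^-1` I)); split => //.
    by apply: measurableC; exact: measurable_funPTI.
  rewrite [LHS]probability_setC; last exact: measurable_funPTI.
  have -> : P (xi i @^-1` I) = P (xi 0%N @^-1` I) by exact: hid.
  by rewrite hxiI subee.
(* Extension by 0 off [I] turns [D ^~ t] into a Borel function on the whole line, as the strong law
   requires. *)
pose g t : R -> R := (D ^~ t) \_ I.
have gE t w : deviation_rv I D (xi 0%N) t w = g t (xi 0%N w).
  by rewrite /deviation_rv /g !patchE; congr (if _ then _ else _).
have gI t x : I x -> g t x = D x t by move=> Ix; rewrite /g patchE mem_set.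
have mg t : I t -> measurable_fun setT (g t).
  by move=> It; apply/(measurable_restrictT _ mI); exact: hborel.
have mgX t : I t -> measurable_fun setT (g t \o xi 0%N).
  by move=> It; apply: measurableT_comp => //; exact: mg.
set m := deviation_mean_rv I D (xi 0%N).
have [exm intm] := hint.
have [domm Em] : is_deviation_mean_rv I D (xi 0%N) m by exact: getPex.
have intg t : deviation_dom I D (xi 0%N) t ->
    P.-integrable setT (EFin \o (g t \o xi 0%N)).
  move=> [It Eoo]; apply/integrableP; split.
    by apply/measurable_EFinP; exact: mgX.
  move: Eoo; rewrite unlock; apply: le_lt_trans.
  rewrite le_eqVlt; apply/orP; left; apply/eqP; apply: eq_integral => w _.
  by rewrite gE.
pose E t : R := fine (\int[P]_w (g t (xi 0%N w))%:E)%E.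
have Em0 : E m = 0.
  suff -> : E m = fine 'E_P[deviation_rv I D (xi 0%N) m]%E by rewrite Em.
  by rewrite unlock; congr fine; apply: eq_integral => w _; rewrite gE.
(* Strictness survives integration: [g s - g t] is nonnegative everywhere and positive wherever
   [xi 0] lies in [I], that is almost surely. *)
have decrE s t : deviation_dom I D (xi 0%N) s -> deviation_dom I D (xi 0%N) t ->
    s < t -> E t < E s.
  move=> ds dt st; have [Is _] := ds; have [It _] := dt.
  rewrite -lte_fin !fineK; try exact/integrable_fin_num/intg.
  rewrite -sube_gt0 -integralB_EFin//; try exact: intg.
  apply: (@integral_gt0 _ _ _ P (fun w => g s (xi 0%N w) - g t (xi 0%N w))).
  - by apply: measurable_funB; exact: mgX.
  - move=> w; rewrite /g !patchE; case: ifPn => [/set_mem Iw|_]; last by rewrite subrr.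
    by rewrite subr_ge0 ltW// decrD.
  apply: filterS aeI => w /(_ 0%N) Iw.
  by rewrite !gI// subr_gt0 decrD.
have /nbhs_ballP[e /= e0 me] : nbhs m (deviation_dom I D (xi 0%N)) by exact: intm.
(* Countably many radii tending to 0 allow the exceptional null sets to be united; [k.+2] keeps them
   strictly below [e], inside the open ball. *)
pose dl k : R := e / k.+2%:R.
have dl0 k : 0 < dl k by rewrite divr_gt0.
have dle k : dl k < e.
  by rewrite ltr_pdivrMr// ltr_pMr// ltr1n.
have domD k : deviation_dom I D (xi 0%N) (m + dl k).
  by apply: me; rewrite /ball/= opprD addNKr normrN gtr0_norm.
have domB k : deviation_dom I D (xi 0%N) (m - dl k).
  by apply: me; rewrite /ball/= opprD opprK addNKr gtr0_norm.
have slln t : deviation_dom I D (xi 0%N) t -> {ae P, forall w,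
    (\sum_(0 <= i < n) g t (xi i w)) / n%:R @[n --> \oo] --> E t}.
  move=> dt; apply: slln_pairwise_independent => //; last exact: intg.
  by apply: mg; case: dt.
have aeD := ae_foralln (fun k => slln _ (domD k)).
have aeB := ae_foralln (fun k => slln _ (domB k)).
apply: filterS3 aeI aeD aeB => w Iw cvD cvB.
apply/cvgrPdist_lt => eps eps0.
have [k dke] : exists k, dl k < eps.
  exists (Num.bound (eps^-1 * e)); rewrite ltr_pdivrMr// -ltr_pdivrMl//.
  apply: lt_le_trans (archi_boundP _) _; first
    by rewrite mulr_ge0 ?invr_ge0 ?(ltW e0) ?(ltW eps0).
  by rewrite ler_nat leqW.
have sumE t n : \sum_(0 <= i < n) g t (xi i w) = \sum_(i < n) D (xi i w) t.
  by rewrite big_mkord; apply: eq_bigr => i _; exact: gI.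
have EB0 : 0 < E (m - dl k) by rewrite -Em0 decrE// ltrBlDr ltrDl.
have ED0 : E (m + dl k) < 0 by rewrite -Em0 decrE// ltrDl.
(* The shift matches the samples of size [n.+1] and makes the denominators positive, so averages and
   sums have the same sign. *)
move: (cvB k); rewrite -cvg_shiftS => cvBk.
move: (cvD k); rewrite -cvg_shiftS => cvDk.
apply: filterS2 (cvgr_gt _ cvBk _ EB0) (cvgr_lt _ cvDk _ ED0) => n /=.
rewrite !sumE pmulr_lgt0 ?invr_gt0// => sB.
rewrite pmulr_llt0 ?invr_gt0// => sD.
have /andP[dmB dmD] : m - dl k < deviation_mean I D (fun i : 'I_n.+1 => xi i w) < m + dl k.
  apply: deviation_mean_between => //.
  - by case: (domB k).
  - by case: (domD k).
  - by rewrite lerD2l (le_trans _ (ltW (dl0 k)))// oppr_le0 ltW.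
by rewrite distrC; apply: lt_trans dke; rewrite ltr_distl dmB.
Qed.
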